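(* Let $K$ be a field of characteristic $\neq2$ with involution $a\mapsto\bar a$, let $\varepsilon\in\{1,-1\}$ with $\varepsilon=1$ if the involution is nonidentity, and let $\Phi$ be an $n\times n$ Frobenius block with characteristic polynomial $\chi(x)=p(x)^s=x^n+\alpha_1x^{n-1}+\dots+\alpha_n$, $p$ monic irreducible. A nonsingular matrix $X$ with $X=\varepsilon X^*=\Phi^*X\Phi$ exists if and only if (C1) $\chi(x)=\chi^\vee(x)$, and (C2) if the involution is the identity and $\varepsilon=(-1)^n$, then $\deg p(x)>1$. When these hold, one can take $X=[a_{j-i}]_{i,j=1}^n$, where $a_{1-n},\dots,a_{n-1}$ are terms of the $\chi$-recurrent sequence determined by the fragment $v=(a_{-m},\dots,a_m)$ (of length $n$ or $n+1$) equal to: (a) $(\varepsilon\bar\alpha_n-1,0,\dots,0,\alpha_n-\varepsilon)$ if $n=2m$ and $\alpha_n\neq\varepsilon$; (b) $(\alpha_1,-1,0,\dots,0,-1,\alpha_1)$ (and $v=(\alpha_1,-2,\alpha_1)$ for $n=2$) if $n=2m$, $\varepsilon=1$, and the involution is the identity; (c) $(-k,0,\dots,0,k)$ if $n=2m$, $\alpha_n=1$ and the involution is nonidentity, and also if $n=2m+1$, $p(x)=x+\alpha$, $\alpha^{n-1}=-1$; (d) $(\varepsilon,0,\dots,0,1)$ if $n=2m+1$, in every case other than $p(x)=x+\alpha$ with $\alpha^{n-1}=-1$.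
   Context: $M^*=[\bar m_{ji}]$ for $M=[m_{ij}]$. For $f=a_0x^n+\dots+a_n$ with $a_n\ne0$, $f^\vee(x)=\bar a_n^{-1}(\bar a_nx^n+\dots+\bar a_1x+\bar a_0)$. A Frobenius block is an $n\times n$ matrix with ones on the subdiagonal, last column $(-c_n,\dots,-c_1)^T$, zeros elsewhere, and characteristic polynomial $x^n+c_1x^{n-1}+\dots+c_n$ a power of an irreducible polynomial. For $f(x)=\gamma_0x^m+\dots+\gamma_m$, a sequence $(a_q,\dots,a_r)$ is $f$-recurrent if $\gamma_0a_{l+m}+\dots+\gamma_ma_l=0$ for $q\le l\le r-m$. For a nonidentity involution, $k$ is a fixed element with $k=-\bar k\ne0$. *)

(* Defs.v *)
From HB Require Import structures.
From mathcomp Require Import all_boot all_order all_algebra.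
Set Implicit Arguments. Unset Strict Implicit. Unset Printing Implicit Defensive.
Import Order.TTheory GRing.Theory Num.Theory.
Local Open Scope ring_scope.

Section Defs.
Variable K : fieldType.
Variable conj : K -> K.

Definition star (m n : nat) (M : 'M[K]_(m, n)) : 'M[K]_(n, m) := (map_mx conj M)^T.

(* f = a_0 x^d + ... + a_d (d = deg f), a_d = f`_0 <> 0;
   f^vee(x) = conj(a_d)^-1 (conj a_d x^d + ... + conj a_1 x + conj a_0),
   i.e. the coefficient of x^j in f^vee is conj(a_j)/conj(a_d) = conj(f`_(d-j))/conj(f`_0). *)
Definition dual (f : {poly K}) : {poly K} :=
  let d := (size f).-1 in
  (conj (f`_0))^-1 *: \poly_(j < d.+1) conj (f`_(d - j)).

(* Frobenius block: ones on the subdiagonal, last column (-c_n,...,-c_1)^T where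
   char_poly Phi = x^n + c_1 x^(n-1) + ... + c_n (so c_k = (char_poly Phi)`_(n-k)),
   zeros elsewhere.  (The "power of an irreducible" part is a separate hypothesis.) *)
Definition frobenius_shape (n : nat) (Phi : 'M[K]_n) : Prop :=
  forall i j : 'I_n,
    Phi i j = if val j == n.-1 then - (char_poly Phi)`_(val i)
              else ((val i == (val j).+1)%N)%:R.

Definition recurrent_on (f : {poly K}) (a : int -> K) (q r : int) : Prop :=
  forall l : int, q <= l -> l <= r - ((size f).-1)%:Z ->
    \sum_(j < size f) f`_j * a (l + (val j)%:Z) = 0.

Definition toeplitz (n : nat) (a : int -> K) : 'M[K]_n :=
  \matrix_(i < n, j < n) a ((val j)%:Z - (val i)%:Z).

Definition good_form (eps : K) (n : nat) (Phi X : 'M[K]_n) : Prop :=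
  [/\ X \in unitmx, X = eps *: star X & X = star Phi *m X *m Phi].

Definition fragment_works (eps : K) (n : nat) (Phi : 'M[K]_n) (m : nat) (v : int -> K) : Prop :=
  let chi := char_poly Phi in
  let frag a := forall i : int, - (m%:Z) <= i -> i <= m%:Z -> a i = v i in
  (exists a : int -> K, recurrent_on chi a (1 - n%:Z) (n%:Z - 1) /\ frag a) /\
  (forall a : int -> K, recurrent_on chi a (1 - n%:Z) (n%:Z - 1) -> frag a ->
     good_form eps Phi (toeplitz n a)).

End Defs.

(* Main.v *)
Require Import Defs.
From Stdlib Require Import Classical.
From HB Require Import structures.
From mathcomp Require Import all_boot all_order all_algebra.
From mathcomp Require Import zify ring.
Import Order.TTheory GRing.Theory Num.Theory.
Set Implicit Arguments.
Unset Strict Implicit.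
Unset Printing Implicit Defensive.
Local Open Scope ring_scope.

(** The bi-infinite chi-recurrent sequences are a_l = (w Phi^l)_0 for a row w
    (written seqw Phi w), and a polynomial f acts on them through w |-> w f(Phi).
    The Toeplitz matrix X of such a sequence satisfies X = Phi^* X Phi as soon
    as a_(-l) = eps conj(a_l), which it is enough to check on n consecutive
    terms since chi is self-dual.  X is singular iff some nonzero f of degree
    < n annihilates w; by Bezout p^(s-1) then annihilates w too.  This is ruled
    out by the zeros of the fragment: p^(s-1) has degree n - deg p, so at most
    the boundary terms of the fragment survive in its recurrence.
    Conversely, a nonsingular X makes Phi^* conjugate to Phi^-1, so chi is
    self-dual; and if p = x + a and the involution is trivial, comparing
    X N^(n-1) with its transpose, N = Phi + a, gives eps = (-1)^(n-1). *)

(** * Linear recurrences on an interval of integers *)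

Section Recurrence.
Variable K : fieldType.
Implicit Types (f : {poly K}) (a : int -> K).

Lemma recurrent_on_monic f a q r (l : int) : f \is monic ->
  recurrent_on f a q r -> q <= l -> l + ((size f).-1)%:Z <= r ->
  \sum_(j < (size f).-1) f`_j * a (l + (val j)%:Z) + a (l + ((size f).-1)%:Z)
    = 0.
Proof.
move=> fm rec ql lr; have {}lr : l <= r - ((size f).-1)%:Z by rewrite lerBrDr.
rewrite -[RHS](rec l ql lr).
rewrite -!(big_mkord xpredT (fun j => f`_j * a (l + j%:Z))).
have sf : size f = (size f).-1.+1.
  by rewrite prednK // size_poly_gt0 monic_neq0.
have lf : f`_(size f).-1 = 1 by apply/eqP.
by rewrite [in RHS]sf big_nat_recr //= lf mul1r.
Qed.

(** Zeros spread to the right because the leading coefficient is 1, and to the left because the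
    constant coefficient is invertible; hence the two inductions [fwd] and [bwd]. *)
Lemma recurrent_on_zero f a q r (t : int) : f \is monic -> f`_0 != 0 ->
  recurrent_on f a q r -> q <= t -> t + ((size f).-1)%:Z - 1 <= r ->
  (forall i : int, t <= i -> i < t + ((size f).-1)%:Z -> a i = 0) ->
  forall i : int, q <= i -> i <= r -> a i = 0.
Proof.
move=> fm f0 rec qt tr win.
have fwd k : t + k%:Z <= r -> a (t + k%:Z) = 0.
  elim/ltn_ind: k => k IHk kr.
  have [kd|dk] := ltnP k (size f).-1; first by apply: win; lia.
  have -> : t + k%:Z = (t + (k - (size f).-1)%N%:Z) + ((size f).-1)%:Z by lia.
  have := recurrent_on_monic (l := t + (k - (size f).-1)%N%:Z) fm rec.
  rewrite big1 ?add0r => [->//|j _]; try lia.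
  have jd : (val j < (size f).-1)%N := ltn_ord j.
  have -> : t + (k - (size f).-1)%N%:Z + (val j)%:Z =
            t + (k - (size f).-1 + val j)%N%:Z by lia.
  by rewrite IHk ?mulr0 //; lia.
have bwd k : q <= t - k%:Z -> t - k%:Z <= r -> a (t - k%:Z) = 0.
  elim/ltn_ind: k => k IHk kq kr; case: k IHk kq kr => [|k] IHk kq kr.
    by have -> : t - 0%:Z = t + 0%:Z by []; apply: fwd; lia.
  have /eqP := rec (t - k.+1%:Z) kq ltac:(lia).
  have sf0 : (0 < size f)%N by rewrite size_poly_gt0 monic_neq0.
  rewrite (bigD1 (Ordinal sf0)) //= big1 ?addr0.
    by rewrite mulf_eq0 (negPf f0) /= => /eqP.
  move=> j; rewrite -val_eqE /= => j0; have jd : (j < size f)%N := ltn_ord j.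
  have [jk|kj] := leqP j k.
    have -> : t - k.+1%:Z + (nat_of_ord j)%:Z = t - (k.+1 - j)%N%:Z by lia.
    by rewrite IHk ?mulr0 //; lia.
  have -> : t - k.+1%:Z + (nat_of_ord j)%:Z = t + (j - k.+1)%N%:Z by lia.
  by rewrite fwd ?mulr0 //; lia.
move=> i qi ir; have [ti|it] := leP t i.
  by have -> : i = t + `|i - t|%N%:Z; [lia|apply: fwd; lia].
by have -> : i = t - `|i - t|%N%:Z; [lia|apply: bwd; lia].
Qed.

Lemma recurrent_on_unique f a b q r (t : int) : f \is monic -> f`_0 != 0 ->
  recurrent_on f a q r -> recurrent_on f b q r ->
  q <= t -> t + ((size f).-1)%:Z - 1 <= r ->
  (forall i : int, t <= i -> i < t + ((size f).-1)%:Z -> a i = b i) ->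
  forall i : int, q <= i -> i <= r -> a i = b i.
Proof.
move=> fm f0 ra rb qt tr win i qi ir; apply/eqP; rewrite -subr_eq0; apply/eqP.
apply: (@recurrent_on_zero f (fun i => a i - b i) q r t) => //
  [l ql lr|j tj jt].
  under eq_bigr do rewrite mulrBr.
  by rewrite sumrB ra // rb // subrr.
by rewrite win // subrr.
Qed.

End Recurrence.

(** * Frobenius blocks and the sequences they generate *)

Section Companion.
Variables (K : fieldType) (n : nat) (Phi : 'M[K]_n.+1).
Hypothesis PhiF : frobenius_shape Phi.
Let chi := char_poly Phi.
Implicit Types (f g : {poly K}) (w : 'rV[K]_n.+1).

Lemma frobenius_mul_delta k : (k < n)%N ->
  Phi *m delta_mx (inord k) 0 = delta_mx (inord k.+1) 0 :> 'cV_n.+1.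
Proof.
move=> kn; apply/matrixP=> i j; rewrite !mxE (bigD1 (inord k)) //= big1.
  rewrite mxE eqxx /= ord1 eqxx mulr1 addr0 PhiF /= !inordK ?ltnS ?(ltnW kn) //.
  by rewrite (ltn_eqF kn) -val_eqE /= inordK // andbT.
by move=> l lk; rewrite mxE (negPf lk) mulr0.
Qed.

Lemma frobenius_exp_delta k : (k < n.+1)%N ->
  Phi ^+ k *m delta_mx 0 0 = delta_mx (inord k) 0 :> 'cV_n.+1.
Proof.
elim: k => [|k IHk] kn.
  by rewrite expr0 mul1mx; congr delta_mx; apply: val_inj; rewrite /= inordK.
by rewrite exprS -mulmxE -mulmxA IHk ?(ltnW kn) // frobenius_mul_delta.
Qed.

Lemma horner_mx_sum f N : (size f <= N)%N ->
  horner_mx Phi f = \sum_(j < N) f`_j *: Phi ^+ j.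
Proof.
move=> fN; rewrite [in LHS](_ : f = \poly_(j < N) f`_j); last first.
  apply/polyP=> i; rewrite coef_poly; case: ltnP => // Ni.
  by rewrite nth_default // (leq_trans fN).
rewrite poly_def linear_sum; apply: eq_bigr => j _.
by rewrite linearZ /= rmorphXn /= horner_mx_X.
Qed.

(** [Phi ^+ k] sends the first basis vector to the k-th one. In particular no nonzero polynomial of
    degree at most n annihilates [Phi]. *)
Lemma frobenius_horner f (i : 'I_n.+1) : (size f <= n.+1)%N ->
  (horner_mx Phi f) i 0 = f`_i.
Proof.
move=> fn; have -> : (horner_mx Phi f) i 0 =
    (horner_mx Phi f *m delta_mx 0 0 : 'cV_n.+1) i 0.
  by rewrite -colE mxE.
rewrite (horner_mx_sum fn) mulmx_suml summxE (bigD1 i) //= big1 => [|j ji].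
  by rewrite -scalemxAl frobenius_exp_delta // !mxE inord_val !eqxx mulr1 addr0.
rewrite -scalemxAl frobenius_exp_delta // !mxE inord_val eq_sym (negPf ji).
by rewrite mulr0.
Qed.

Hypothesis PhiU : Phi \in unitmx.

Definition seqw w (l : int) : K := (w *m Phi ^ l) 0 0.

Lemma seqw_shift w l k : seqw w (l + k) = seqw (w *m Phi ^ l) k.
Proof. by rewrite /seqw exprzDr // -mulmxE mulmxA. Qed.

(** The column [Phi ^+ j] e_0 is e_j. With [seqw_shift], any n+1 consecutive terms are the
    coordinates of some [w *m Phi ^ l], so they determine [w] and can be prescribed freely. *)
Lemma seqw_nat w (j : 'I_n.+1) : seqw w (val j)%:Z = w 0 j.
Proof.
rewrite /seqw -exprnP.
have -> : (w *m Phi ^+ val j) 0 0 =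
    (w *m (Phi ^+ val j *m delta_mx 0 0 : 'cV_n.+1)) 0 0.
  by rewrite mulmxA -colE [RHS]mxE.
by rewrite frobenius_exp_delta ?ltn_ord // -colE mxE inord_val.
Qed.

Lemma seqw_eq0 w l :
  (forall j : 'I_n.+1, seqw w (l + (val j)%:Z) = 0) -> w = 0.
Proof.
move=> w0; have wl : w *m Phi ^ l = 0.
  by apply/rowP=> j; rewrite -seqw_nat -seqw_shift w0 mxE.
have Ul : Phi ^ l \is a GRing.unit by rewrite unitrXz.
by rewrite -[w](mulmxK Ul) wl mul0mx.
Qed.

Lemma seqw_exists (v : int -> K) (l : int) :
  exists w, forall j : 'I_n.+1, seqw w (l + (val j)%:Z) = v (l + (val j)%:Z).
Proof.
have Ul : Phi ^ l \is a GRing.unit by rewrite unitrXz.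
pose u : 'rV[K]_n.+1 := \row_j v (l + (val j)%:Z).
exists (u *m invmx (Phi ^ l)) => j.
by rewrite seqw_shift mulmxKV // seqw_nat mxE.
Qed.

Lemma seqw_horner w f N (l : int) : (size f <= N)%N ->
  \sum_(j < N) f`_j * seqw w (l + (val j)%:Z) = seqw (w *m horner_mx Phi f) l.
Proof.
move=> fN; rewrite (horner_mx_sum fN) /seqw mulmx_sumr mulmx_suml summxE.
apply: eq_bigr => j _; rewrite -scalemxAr -scalemxAl [RHS]mxE addrC.
by rewrite exprzDr // -mulmxE mulmxA.
Qed.

Lemma seqw0 l : seqw 0 l = 0.
Proof. by rewrite /seqw mul0mx mxE. Qed.

Lemma seqw_recurrent w f q r : w *m horner_mx Phi f = 0 ->
  recurrent_on f (seqw w) q r.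
Proof. by move=> wf l _ _; rewrite seqw_horner // wf seqw0. Qed.

Lemma seqw_char_recurrent w q r : recurrent_on chi (seqw w) q r.
Proof. by apply: seqw_recurrent; rewrite Cayley_Hamilton mulmx0. Qed.

Lemma seqw_char w (l : int) :
  \sum_(j < n.+2) chi`_j * seqw w (l + (val j)%:Z) = 0.
Proof.
by rewrite seqw_horner ?size_char_poly // Cayley_Hamilton mulmx0 seqw0.
Qed.

End Companion.

(** * Proper divisors of a power of an irreducible polynomial *)

Section IrreduciblePower.
Variable K : fieldType.
Implicit Types p f g : {poly K}.

Lemma irreducible_coprimep p f :
  irreducible_poly p -> ~~ (p %| f) -> coprimep p f.
Proof.
move=> pirr pf; apply/coprimepP => d dp df.
have [//|dep] := irredp_XsubCP pirr dp.
by rewrite -(eqp_dvdl f dep) df in pf.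
Qed.

(** Let h be the quotient of [p ^+ s] by [g]. If [p] divides h, cancel one factor [p]. Otherwise h
    is coprime to [p ^+ s], which it divides, so h is constant, against the size assumption. *)
Lemma dvdp_exp_pred g p s : irreducible_poly p -> g %| p ^+ s ->
  (size g < size (p ^+ s)%R)%N -> g %| p ^+ s.-1.
Proof.
move=> pirr; case: s => [|s] gp.
  have g0 : g != 0 by apply: contraTneq gp => ->; rewrite dvd0p expr0 oner_eq0.
  by rewrite expr0 size_poly1 ltnS leqn0 size_poly_eq0 (negPf g0).
have p0 := irredp_neq0 pirr.
have hg := divpK gp; move: hg; set h := p ^+ s.+1 %/ g => hg.
have hn0 : h != 0.
  by apply: contra_eq_neq hg => ->; rewrite mul0r eq_sym expf_neq0.
have gn0 : g != 0.
  by apply: contra_eq_neq hg => ->; rewrite mulr0 eq_sym expf_neq0.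
have [/dvdpP [h' hE] _|nph sg] := boolP (p %| h).
  apply/dvdpP; exists h'; apply: (mulfI p0).
  by rewrite -exprS -hg hE mulrCA mulrA.
have chp : coprimep h (p ^+ s.+1).
  by apply: coprimep_expr; rewrite coprimep_sym irreducible_coprimep.
have /coprimepP/(_ h (dvdpp h)) := chp.
rewrite -[X in _ %| X]hg dvdp_mulr // -size_poly_eq1 => /(_ isT)/eqP h1.
by move: sg; rewrite -hg size_mul // h1 add1n ltnn.
Qed.

End IrreduciblePower.

(** * Toeplitz matrices of recurrent sequences: nonsingularity and shifts *)

Section Toeplitz.
Variables (K : fieldType) (n : nat) (Phi : 'M[K]_n.+1).
Hypothesis PhiF : frobenius_shape Phi.
Hypothesis PhiU : Phi \in unitmx.
Let chi := char_poly Phi.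
Implicit Types (w : 'rV[K]_n.+1) (p : {poly K}).

(* X u is the list of values of the sequence w u(Phi) at n + 1 consecutive
   places, so X is singular exactly when some nonzero u of degree at most n
   satisfies w u(Phi) = 0. *)
Lemma toeplitz_seqw_unit w p s : irreducible_poly p ->
  chi = p ^+ s -> w *m horner_mx Phi (p ^+ s.-1) != 0 ->
  toeplitz n.+1 (seqw Phi w) \in unitmx.
Proof.
move=> pirr chip; apply: contraNT.
rewrite unitmxE unitfE negbK -det_tr => /det0P[u u0 uX].
pose f := rVpoly u.
have sf : (size f <= n.+1)%N by apply: size_poly.
have wf : w *m horner_mx Phi f = 0.
  apply: (seqw_eq0 PhiF PhiU (l := - n%:Z)) => j.
  have -> : - n%:Z + (val j)%:Z = - (val (rev_ord j))%:Z.
    by have /= := ltn_ord j; rewrite subSS; lia.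
  have /rowP/(_ (rev_ord j)) := uX; rewrite !mxE => <-.
  rewrite -(seqw_horner _ _ _ sf) //; apply: eq_bigr => k _.
  by rewrite !mxE coef_rVpoly_ord addrC.
have [[a b] /= gE] := Bezoutp f (p ^+ s).
have f0 : f != 0.
  apply: contraNneq u0 => f0; apply/eqP/rowP=> j.
  by rewrite mxE -coef_rVpoly_ord -/f f0 coef0.
(* The gcd divides [f], so its degree is at most n and it is a proper divisor of [p ^+ s]. *)
have /dvdpP[h ->] : a * f + b * p ^+ s %| p ^+ s.-1.
  rewrite (eqp_dvdl _ gE); apply: dvdp_exp_pred => //; first exact: dvdp_gcdr.
  rewrite -chip size_char_poly ltnS (leq_trans _ sf) //.
  by rewrite dvdp_leq // dvdp_gcdl.
have -> : h * (a * f + b * p ^+ s) = f * (h * a) + p ^+ s * (h * b) by ring.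
rewrite rmorphD !(rmorphM _ _ (h * _)) /= -chip Cayley_Hamilton mul0r addr0.
by rewrite -mulmxE mulmxA wf mul0mx.
Qed.

(** The row of terms l, ..., l+n is [w *m Phi ^ l], so multiplying it by [Phi] on the right moves
    the window one place forward. *)
Lemma sum_seqw_frobenius w (l : int) (j : 'I_n.+1) :
  \sum_k seqw Phi w (l + (val k)%:Z) * Phi k j
    = seqw Phi w (l + (val j)%:Z + 1).
Proof.
have -> : l + (val j)%:Z + 1 = l + (val j).+1%:Z by lia.
have -> : seqw Phi w (l + (val j).+1%:Z) =
    (w *m Phi ^ l *m Phi ^+ (val j).+1) 0 0.
  by rewrite seqw_shift // -exprnP.
rewrite exprS -mulmxE.
have -> : (w *m Phi ^ l *m (Phi *m Phi ^+ val j)) 0 0 =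
  (w *m Phi ^ l *m Phi *m (Phi ^+ val j *m delta_mx 0 0 : 'cV_n.+1)) 0 0.
  by rewrite !mulmxA -colE [RHS]mxE.
rewrite frobenius_exp_delta ?ltn_ord // -colE mxE inord_val mxE.
by apply: eq_bigr => k _; rewrite seqw_shift // seqw_nat.
Qed.

End Toeplitz.

(** * Symmetric sequences for a self-dual characteristic polynomial *)

Section Hermitian.
Variables (K : fieldType) (conj : {rmorphism K -> K}) (eps : K) (n : nat).
Variable Phi : 'M[K]_n.+1.
Hypothesis PhiF : frobenius_shape Phi.
Let chi := char_poly Phi.
Hypothesis chi0 : chi`_0 != 0.
Hypothesis chi_dual : chi = dual conj chi.
Implicit Types (w : 'rV[K]_n.+1) (p : {poly K}).

Lemma frobenius_unit : Phi \in unitmx.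
Proof.
by move: chi0; rewrite char_poly_det mulf_eq0 signr_eq0 /= unitmxE unitfE.
Qed.
Let PhiU := frobenius_unit.

(** Conjugating the [chi]-recurrence and reading it backwards gives the recurrence of
    [dual conj chi], up to a scalar factor; the substitution j -> n+1-j performs the reversal. *)
Lemma reverse_recurrent w q r :
  recurrent_on chi (fun k => eps * conj (seqw Phi w (- k))) q r.
Proof.
move=> l _ _; rewrite size_char_poly.
have char_dual_coef (j : nat) : (j <= n.+1)%N ->
    chi`_j = (conj chi`_0)^-1 * conj chi`_(n.+1 - j).
  move=> jn; rewrite [in LHS]chi_dual /dual coefZ size_char_poly coef_poly.
  by rewrite ltnS jn.
under eq_bigr => j _.
  rewrite char_dual_coef -1?ltnS // mulrCA -mulrA -rmorphM.
  over.
rewrite -mulr_sumr -mulr_sumr -rmorph_sum /= (reindex_inj rev_ord_inj) /=.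
have := seqw_char PhiU w (- l - n.+1%:Z) => E.
rewrite [X in _ * conj X](_ : _ = 0) ?rmorph0 ?mulr0 // -[RHS]E.
apply: eq_bigr => j _; have jn := ltn_ord j.
rewrite subSS subKn -1?ltnS //; congr (_ * seqw _ _ _).
by move: jn; rewrite /=; lia.
Qed.

Lemma seqw_hermitian w (t : int) :
  (forall i : int, t <= i -> i < t + n.+1%:Z ->
     seqw Phi w i = eps * conj (seqw Phi w (- i))) ->
  forall i, seqw Phi w i = eps * conj (seqw Phi w (- i)).
Proof.
move=> win i; have sc : (size chi).-1 = n.+1 by rewrite size_char_poly.
(* The interval is stretched by |i - t| on both sides so that it contains both i and the window. *)
apply: (@recurrent_on_unique _ chi (seqw Phi w)
  (fun k => eps * conj (seqw Phi w (- k))) (t - `|i - t|%N%:Z)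
  (t + n.+1%:Z + `|i - t|%N%:Z) t) => //; rewrite ?sc; try lia.
- exact: char_poly_monic.
- exact: seqw_char_recurrent.
- exact: reverse_recurrent.
- exact: win.
Qed.

(** By the symmetry of the sequence, multiplying by [star conj Phi] on the left shifts it one place
    back; multiplying by [Phi] on the right shifts it forward again. *)
Lemma good_form_toeplitz w :
  (forall i, seqw Phi w i = eps * conj (seqw Phi w (- i))) ->
  toeplitz n.+1 (seqw Phi w) \in unitmx ->
  good_form conj eps Phi (toeplitz n.+1 (seqw Phi w)).
Proof.
move=> herm Xu; split=> //.
  by apply/matrixP=> i j; rewrite !mxE herm opprB.
have -> : star conj Phi *m toeplitz n.+1 (seqw Phi w)
        = toeplitz n.+1 (seqw Phi (w *m Phi ^ (-1))).
  apply/matrixP=> i j; rewrite !mxE -(seqw_shift PhiU).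
  have -> : -1 + ((val j)%:Z - (val i)%:Z) = - (- (val j)%:Z + (val i)%:Z + 1).
    by lia.
  rewrite [RHS]herm opprK.
  rewrite -(sum_seqw_frobenius PhiF PhiU) rmorph_sum mulr_sumr.
  apply: eq_bigr => k _; rewrite !mxE rmorphM mulrC [in LHS]herm.
  by rewrite opprB addrC mulrA.
apply/matrixP=> i j; rewrite !mxE.
under eq_bigr => k _ do rewrite mxE addrC.
rewrite (sum_seqw_frobenius PhiF PhiU) -(seqw_shift PhiU).
by congr seqw; lia.
Qed.

(** For even order the fragment has one term more than the degree of [chi], so it must itself
    satisfy one instance of the recurrence. For odd order it is exactly a window of free terms. *)
Lemma fragment_worksP p s m (v : int -> K) : irreducible_poly p ->
  chi = p ^+ s -> n.+1 = (2 * m)%N \/ n.+1 = (2 * m).+1 ->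
  (forall i : int, - m%:Z <= i -> i <= m%:Z -> v i = eps * conj (v (- i))) ->
  (n.+1 = (2 * m)%N ->
     \sum_(j < n.+2) chi`_j * v (- m%:Z + (val j)%:Z) = 0) ->
  (forall w, (forall i : int, - m%:Z <= i -> i <= m%:Z -> seqw Phi w i = v i) ->
     w *m horner_mx Phi (p ^+ s.-1) != 0) ->
  fragment_works conj eps Phi m v.
Proof.
move=> pirr chip nm hv compat nk.
have [w wE] := seqw_exists PhiF PhiU v (- m%:Z).
have sc : size chi = n.+2 by rewrite size_char_poly.
have {}wE (i : int) : - m%:Z <= i -> i <= m%:Z -> seqw Phi w i = v i.
  move=> mi im.
  have nat_win (k : nat) : (k <= n)%N ->
      seqw Phi w (- m%:Z + k%:Z) = v (- m%:Z + k%:Z).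
    by rewrite -ltnS => kn; have := wE (Ordinal kn).
  (* This index lies in the fragment only for even order, where it equals m; that last term comes
     from the recurrence at -m, since [chi] is monic. *)
  have [iE|in1] := eqVneq i (- m%:Z + n.+1%:Z); last first.
    have -> : i = - m%:Z + (absz (i + m%:Z))%:Z by lia.
    by apply: nat_win; lia.
  have n2m : n.+1 = (2 * m)%N by move: im; rewrite iE; lia.
  rewrite iE.
  have := seqw_char PhiU w (- m%:Z).
  rewrite -[RHS](compat n2m) !(big_ord_recr n.+1) /=.
  have -> : (char_poly Phi)`_n.+1 = 1.
    by have /monicP := char_poly_monic Phi; rewrite lead_coefE size_char_poly.
  rewrite !mul1r.
  under eq_bigr => j _ do rewrite nat_win -1?ltnS //.
  by move/addrI.
have good : good_form conj eps Phi (toeplitz n.+1 (seqw Phi w)).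
  apply: good_form_toeplitz.
    apply: (@seqw_hermitian w (- m%:Z)) => i mi im.
    by rewrite !wE; [apply: hv| | | |]; lia.
  by apply: (toeplitz_seqw_unit PhiF PhiU pirr chip); apply: nk.
split; first by exists (seqw Phi w); split=> //; apply: seqw_char_recurrent.
move=> a ra fa.
suff -> : toeplitz n.+1 a = toeplitz n.+1 (seqw Phi w) by [].
apply/matrixP=> i j; rewrite !mxE.
have iB : (val i < n.+1)%N := ltn_ord i.
have jB : (val j < n.+1)%N := ltn_ord j.
apply: (@recurrent_on_unique _ chi a (seqw Phi w) 
  (1 - n.+1%:Z) (n.+1%:Z - 1) (- m%:Z)) => //;
  rewrite ?sc; try lia.
- exact: char_poly_monic.
- exact: seqw_char_recurrent.
- move=> k mk km; have mk' : k <= m%:Z by lia.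
  by rewrite (fa k mk mk') (wE k mk mk').
Qed.

End Hermitian.

(** * Sums supported near their ends, and low coefficients of powers *)

Section EndSums.
Variable K : fieldType.
Implicit Types F : nat -> K.

Lemma sum_ends F N : (0 < N)%N ->
  (forall j, (0 < j < N)%N -> F j = 0) ->
  \sum_(j < N.+1) F (val j) = F 0%N + F N.
Proof.
case: N => // N _ F0; rewrite big_ord_recr big_ord_recl /= big1 ?addr0 //.
by move=> j _; apply: F0; rewrite /= /bump add1n ltnS ltn_ord.
Qed.

Lemma sum_two_ends F N : (1 < N)%N ->
  (forall j, (1 < j < N)%N -> F j = 0) ->
  \sum_(j < N.+2) F (val j) = F 0%N + F 1%N + F N + F N.+1.
Proof.
case: N => [|[|N]] // _ F0.
rewrite big_ord_recr big_ord_recr big_ord_recl big_ord_recl /= big1 ?addr0 //.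
by move=> j _; apply: F0; rewrite /= /bump !add1n !ltnS ltn_ord.
Qed.

Lemma sum_first_two F N : (forall j, (1 < j < N.+2)%N -> F j = 0) ->
  \sum_(j < N.+2) F (val j) = F 0%N + F 1%N.
Proof.
move=> F0; rewrite big_ord_recl big_ord_recl /= big1 ?addr0 //.
by move=> j _; apply: F0; rewrite /= /bump !add1n !ltnS ltn_ord.
Qed.

Lemma coef0_exp (p : {poly K}) k : (p ^+ k)`_0 = p`_0 ^+ k.
Proof. by rewrite -!horner_coef0 horner_exp. Qed.

Lemma coef1_exp (p : {poly K}) k : (p ^+ k)`_1 = p`_0 ^+ k.-1 * p`_1 *+ k.
Proof.
have d1 (q : {poly K}) : q`_1 = q^`()`_0 by rewrite coef_deriv mulr1n.
by rewrite !d1 deriv_exp coefMn coef0M coef0_exp mulrC.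
Qed.

End EndSums.

(** * The explicit fragments *)

Section Fragments.
Variables (K : fieldType) (conj : {rmorphism K -> K}) (eps : K) (n : nat).
Variables (Phi : 'M[K]_n.+1) (p : {poly K}) (s : nat).
Hypothesis conjK : involutive conj.
Hypothesis epsP : eps = 1 \/ eps = -1.
Hypothesis PhiF : frobenius_shape Phi.
Let chi := char_poly Phi.
Hypothesis chi0 : chi`_0 != 0.
Hypothesis chi_dual : chi = dual conj chi.
Hypothesis pm : p \is monic.
Hypothesis pirr : irreducible_poly p.
Hypothesis chip : chi = p ^+ s.
Implicit Types (w : 'rV[K]_n.+1).

Let epsK : eps * eps = 1.
Proof. by case: epsP => ->; rewrite ?mulrNN mulr1. Qed.

Let conj_eps : conj eps = eps.
Proof. by case: epsP => ->; rewrite ?rmorphN rmorph1. Qed.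

Let PhiU := frobenius_unit chi0.

Lemma exponent_degree : (s * (size p).-1 = n.+1)%N.
Proof.
by rewrite mulnC -size_exp -chip size_char_poly.
Qed.

Lemma exponent_gt0 : (0 < s)%N.
Proof. by have := exponent_degree; case: s. Qed.

Let g := p ^+ s.-1.

Lemma degree_cofactor : ((size g).-1 + (size p).-1 = n.+1)%N.
Proof.
rewrite size_exp -exponent_degree -[in RHS](prednK exponent_gt0).
by rewrite mulSn addnC mulnC.
Qed.

Lemma cofactor_monic : g \is monic.
Proof. exact: monic_exp. Qed.

Lemma size_cofactor : size g = (size g).-1.+1.
Proof. by rewrite prednK // size_poly_gt0 monic_neq0 ?cofactor_monic. Qed.

Lemma cofactor_lead : g`_(size g).-1 = 1.
Proof. by apply/monicP/cofactor_monic. Qed.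

Lemma coef0_cofactor : g`_0 != 0.
Proof.
move: chi0; rewrite chip !coef0_exp.
rewrite -[in X in X -> _](prednK exponent_gt0) exprS.
by rewrite mulf_eq0 negb_or => /andP[].
Qed.

Lemma char_coef_dual (j : nat) : (j <= n.+1)%N ->
  chi`_j = (conj chi`_0)^-1 * conj chi`_(n.+1 - j).
Proof.
move=> jn; rewrite [in LHS]chi_dual /dual coefZ size_char_poly coef_poly.
by rewrite ltnS jn.
Qed.

Lemma char_lead : chi`_n.+1 = 1.
Proof.
by have /monicP := char_poly_monic Phi; rewrite lead_coefE size_char_poly.
Qed.

(** Compare constant coefficients in [chi = dual conj chi], with [chi] monic. *)
Lemma char_coef0_norm : chi`_0 * conj chi`_0 = 1.
Proof.
rewrite {1}char_coef_dual // subn0 char_lead rmorph1 mulr1.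
by rewrite mulVf // fmorph_eq0.
Qed.

Lemma annihilated_recurrence w (l : int) : w *m horner_mx Phi g = 0 ->
  \sum_(j < (size g).-1.+1) g`_j * seqw Phi w (l + (val j)%:Z) = 0.
Proof.
by move=> wg; rewrite seqw_horner -?size_cofactor // wg seqw0.
Qed.

Lemma annihilated_zero w (t : int) : w *m horner_mx Phi g = 0 ->
  (forall i : int, t <= i -> i < t + ((size g).-1)%:Z -> seqw Phi w i = 0) ->
  forall i, seqw Phi w i = 0.
Proof.
move=> wg win i.
apply: (@recurrent_on_zero _ g (seqw Phi w) (t - `|i - t|%N%:Z)
  (t + ((size g).-1)%:Z + `|i - t|%N%:Z) t) => //; try lia.
- exact: cofactor_monic.
- exact: coef0_cofactor.
- exact: seqw_recurrent.
Qed.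

(** Serves (a) and the even half of (c). The last hypothesis is the recurrence at -m. The 2m-1 inner
    zeros are at least as many as the degree of [g], so if [g] annihilated [w] the whole sequence
    would vanish, including x. *)
Lemma even_fragment m (x y : K) : n.+1 = (2 * m)%N -> x != 0 ->
  x = eps * conj y -> chi`_0 * x + y = 0 ->
  fragment_works conj eps Phi m
    (fun i : int => if i == - m%:Z then x else if i == m%:Z then y else 0).
Proof.
move=> nm x0 xy xy0.
have yx : y = eps * conj x.
  by rewrite xy rmorphM conj_eps conjK mulrA epsK mul1r.
set v := (fun i : int => if i == - m%:Z then x else if i == m%:Z then y else 0).
have vl : v (- m%:Z) = x by rewrite /v eqxx.
have vr : v m%:Z = y by rewrite /v eqxx ifF //; apply/eqP; lia.
have vi (i : int) : i != - m%:Z -> i != m%:Z -> v i = 0.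
  by rewrite /v => /negPf-> /negPf->.
apply: (fragment_worksP PhiF chi0 chi_dual pirr chip); first by left.
- move=> i mi im; have [->|im1] := eqVneq i (- m%:Z).
    by rewrite opprK vl vr.
  have [->|im2] := eqVneq i m%:Z; first by rewrite vl vr.
  rewrite !vi ?rmorph0 ?mulr0 ?eqr_opp //.
  by apply: contra_neq im1 => <-; rewrite opprK.
- move=> _; rewrite (sum_ends (F := fun j => chi`_j * v (- m%:Z + j%:Z))) //.
    have -> : - m%:Z + n.+1%:Z = m%:Z by lia.
    by rewrite char_lead mul1r addr0 vl vr.
  by move=> j jn; rewrite vi ?mulr0 //; apply/eqP; lia.
move=> w wv; apply: contraNneq x0 => wg.
rewrite -vl -(wv (- m%:Z)) //; last by lia.
apply/eqP; apply: (annihilated_zero wg (t := 1 - m%:Z)) => i mi im.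
have dg := degree_cofactor; have dp : (1 < size p)%N := pirr.1.
by rewrite wv ?vi //; lia.
Qed.

(** Serves (d) and the odd half of (c). For m = 0 both ends are the same term, whence the condition
    y = x. *)
Lemma odd_fragment m (x y : K) : n.+1 = (2 * m).+1 -> x != 0 ->
  x = eps * conj y -> (m = 0%N -> y = x) ->
  (size p = 2%N -> (0 < m)%N -> p`_0 ^+ n * x + y != 0) ->
  fragment_works conj eps Phi m
    (fun i : int => if i == - m%:Z then x else if i == m%:Z then y else 0).
Proof.
move=> nm x0 xy m0 nz.
have yx : y = eps * conj x.
  by rewrite xy rmorphM conj_eps conjK mulrA epsK mul1r.
set v := (fun i : int => if i == - m%:Z then x else if i == m%:Z then y else 0).
have vl : v (- m%:Z) = x by rewrite /v eqxx.
have vr : v m%:Z = y.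
  case: (posnP m) => [mE|m1]; first by rewrite m0 // -vl mE oppr0.
  by rewrite /v eqxx ifF //; apply/eqP; lia.
have vi (i : int) : i != - m%:Z -> i != m%:Z -> v i = 0.
  by rewrite /v => /negPf-> /negPf->.
apply: (fragment_worksP PhiF chi0 chi_dual pirr chip); first by right.
- move=> i mi im; have [->|im1] := eqVneq i (- m%:Z).
    by rewrite opprK vl vr.
  have [->|im2] := eqVneq i m%:Z; first by rewrite vl vr.
  rewrite !vi ?rmorph0 ?mulr0 ?eqr_opp //.
  by apply: contra_neq im1 => <-; rewrite opprK.
- lia.
move=> w wv; apply/eqP => wg.
have dg := degree_cofactor; have dp : (1 < size p)%N := pirr.1.
have [gm|gm] := leqP (size g).-1 (2 * m).-1.
  move/eqP: x0; apply; rewrite -vl -(wv (- m%:Z)) //; last by lia.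
  apply: (annihilated_zero wg (t := 1 - m%:Z)) => i mi im.
  by rewrite wv ?vi //; lia.
(* The inner zeros are too few only when [p] is linear, so that [g] has degree n = 2m. Its
   recurrence at -m then involves just the two ends and contradicts the last hypothesis. *)
have p2 : size p = 2%N by lia.
have m1 : (0 < m)%N by lia.
have gE : (size g).-1 = n by lia.
have sE : s.-1 = n by move: gE; rewrite size_exp p2 mul1n.
have := annihilated_recurrence (- m%:Z) wg; rewrite gE.
rewrite (sum_ends (F := fun j => g`_j * seqw Phi w (- m%:Z + j%:Z))).
- have -> : - m%:Z + n%:Z = m%:Z by lia.
  rewrite addr0 !wv ?vl ?vr; try lia.
  by rewrite -gE cofactor_lead mul1r coef0_exp sE; apply/eqP; apply: nz.
- lia.
by move=> j jn; rewrite wv ?vi ?mulr0 //; lia.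
Qed.

(** There are only 2m-3 inner zeros, so [p] of degree 2 needs a separate argument: annihilation by
    [g] would force p = x^2 - 1, which is reducible. For m = 1 the two entries -1 fall on the same
    place and add up to -2. *)
Lemma even_symmetric_fragment m : 2%:R != 0 :> K -> n.+1 = (2 * m)%N ->
  eps = 1 -> (forall a, conj a = a) -> (2 < size p)%N ->
  fragment_works conj eps Phi m
    (fun i : int => if (i == - m%:Z) || (i == m%:Z) then chi`_n
       else if (i == 1 - m%:Z) || (i == m%:Z - 1) then
         (if m == 1%N then -2 else -1) else 0).
Proof.
move=> two0 nm eps1 conj1 p3.
set c : K := if m == 1%N then -2 else -1.
set v := (fun i : int => _).
have c0 : c != 0 by rewrite /c; case: ifP; rewrite oppr_eq0 ?oner_eq0.
have v1 (i : int) : i = - m%:Z \/ i = m%:Z -> v i = chi`_n.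
  by rewrite /v => iE; rewrite ifT //; lia.
have v2 (i : int) : i = 1 - m%:Z \/ i = m%:Z - 1 -> v i = c.
  by rewrite /v => iE; rewrite ifF ?ifT //; lia.
have v0 (i : int) : 1 - m%:Z < i -> i < m%:Z - 1 -> v i = 0.
  by rewrite /v => i1 i2; rewrite !ifF //; lia.
have vl : v (- m%:Z) = chi`_n by apply: v1; left.
have vr : v m%:Z = chi`_n by apply: v1; right.
have wl : v (1 - m%:Z) = c by apply: v2; left.
have wr : v (m%:Z - 1) = c by apply: v2; right.
have vN i : v (- i) = v i.
  have e1 : ((- i == - m%:Z) || (- i == m%:Z)) = ((i == - m%:Z) || (i == m%:Z)).
    by lia.
  have e2 : ((- i == 1 - m%:Z) || (- i == m%:Z - 1)) =
            ((i == 1 - m%:Z) || (i == m%:Z - 1)) by lia.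
  by rewrite /v e1 e2.
have chi1 : chi`_1 = chi`_0 * chi`_n.
  rewrite char_coef_dual // !conj1 subSS subn0; congr (_ * _).
  apply: (mulIf chi0); rewrite mulVf //.
  by have := char_coef0_norm; rewrite conj1.
apply: (fragment_worksP PhiF chi0 chi_dual pirr chip); first by left.
- by move=> i _ _; rewrite conj1 vN eps1 mul1r.
- move=> _; have [mE|m1] := eqVneq m 1%N.
    have n1 : n = 1%N by lia.
    have -> : \sum_(j < n.+2) chi`_j * v (- m%:Z + (val j)%:Z)
      = chi`_0 * v (- m%:Z) + chi`_n * v (1 - m%:Z) + chi`_n.+1 * v m%:Z.
      rewrite n1 !big_ord_recl big_ord0 /= /bump /= !addr0 addrA.
      by congr (_ * v _ + _ * v _ + _ * v _); lia.
    rewrite char_lead vl vr wl /c mE /= -n1; have chi1' := chi1.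
    by rewrite n1 in chi1'; rewrite n1 -chi1'; ring.
  have cE : c = -1 by rewrite /c (negPf m1).
  have -> : \sum_(j < n.+2) chi`_j * v (- m%:Z + (val j)%:Z)
    = chi`_0 * v (- m%:Z) + chi`_1 * v (1 - m%:Z) + chi`_n * v (m%:Z - 1)
      + chi`_n.+1 * v m%:Z.
    rewrite (sum_two_ends (F := fun j => chi`_j * v (- m%:Z + j%:Z)));
      last first.
    - by move=> j jn; rewrite v0 ?mulr0 //; lia.
    - lia.
    by rewrite addr0; congr (_ * v _ + _ * v _ + _ * v _ + _ * v _); lia.
  rewrite char_lead vl vr wl wr.
  by rewrite chi1 cE; ring.
move=> w wv; apply/eqP => wg.
have dg := degree_cofactor; have dp : (2 < size p)%N := p3.
(* For m = 1 the truncated difference is 0, which is also the degree of [g], and the window of zeros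
   is empty. *)
have [gm|gm] := leqP (size g).-1 (2 * m - 3).
  move/eqP: c0; apply; rewrite -wl -wv; try lia.
  apply: (annihilated_zero wg (t := 2 - m%:Z)) => i mi im.
  by rewrite wv ?v0 //; lia.
have p3E : size p = 3%N by lia.
have m1 : (1 < m)%N by lia.
have cE : c = -1 by rewrite /c ifF //; lia.
have gE : (size g).-1 = (2 * m - 2)%N by lia.
have sE : s = m by have := exponent_degree; rewrite p3E; lia.
(* The recurrence of [g] at 1-m sees only the two entries -1; the one at -m, used for [g1], sees
   only the first two terms. *)
have g0 : p`_0 ^+ m.-1 = -1.
  have := annihilated_recurrence (1 - m%:Z) wg; rewrite gE.
  rewrite (sum_ends (F := fun j => g`_j * seqw Phi w (1 - m%:Z + j%:Z))).
  - have -> : 1 - m%:Z + (2 * m - 2)%N%:Z = m%:Z - 1 by lia.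
    rewrite addr0 !wv ?wl ?wr; try lia.
    rewrite -gE cofactor_lead mul1r coef0_exp sE cE mulrN1 => /eqP.
    by rewrite subr_eq0 eqr_oppLR => /eqP.
  - lia.
  by move=> j jn; rewrite wv ?v0 ?mulr0 //; lia.
have g1 : g`_1 = - chi`_n.
  have := annihilated_recurrence (- m%:Z) wg; rewrite gE.
  have -> : (2 * m - 2).+1 = (2 * m - 3).+2 by lia.
  rewrite (sum_first_two (F := fun j => g`_j * seqw Phi w (- m%:Z + j%:Z))).
    have -> : - m%:Z + 1%:Z = 1 - m%:Z by lia.
    rewrite addr0 !wv ?vl ?wl; try lia.
    rewrite coef0_exp sE g0 cE mulN1r mulrN1 => /eqP.
    by rewrite subr_eq0 eq_sym => /eqP.
  by move=> j jn; rewrite wv ?v0 ?mulr0 //; lia.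
have chi00 : chi`_0 * chi`_0 = 1 by have := char_coef0_norm; rewrite conj1.
have chi0E : chi`_0 = - p`_0.
  by rewrite chip sE coef0_exp -(prednK (ltnW m1)) exprS g0 mulrN1.
have p00 : p`_0 * p`_0 = 1 by rewrite -chi00 chi0E mulrNN.
have pm1 : p`_0 = -1.
  have /eqP : (p`_0 - 1) * (p`_0 + 1) = 0 by rewrite mulrDr mulrDl p00; ring.
  rewrite mulf_eq0 => /orP[|]; last by rewrite addr_eq0 => /eqP.
  rewrite subr_eq0 => /eqP p01; move/eqP: g0; rewrite p01 expr1n.
  by rewrite -addr_eq0 => /(elimN idP)[]; exact: two0.
(* Now [chi] is palindromic, so the linear coefficients of p^m and p^(m-1) are opposite; they are -m
   b and (m-1) b with b the linear coefficient of [p], whence b = 0. *)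
have b0 : p`_1 = 0.
  have : (p ^+ m)`_1 = - (p ^+ m.-1)`_1.
    rewrite -sE -chip chi1 chi0E pm1 opprK mul1r.
    by move: g1; rewrite /g => ->; rewrite opprK.
  rewrite !coef1_exp g0 -[m.-1](prednK (_ : 0 < m.-1)%N) /=; last by lia.
  have -> : p`_0 ^+ m.-2 = 1.
    apply: (@mulfI _ p`_0); first by rewrite pm1 oppr_eq0 oner_eq0.
    by rewrite -exprS prednK ?g0 ?pm1 ?mulr1 //; lia.
  rewrite prednK; last by lia.
  rewrite mulN1r mul1r mulNrn => /oppr_inj /eqP.
  rewrite -{1}(prednK (ltnW m1)) mulrS -subr_eq0 addrK.
  by move/eqP.
have p1 : root p 1.
  rewrite /root horner_coef p3E !big_ord_recl big_ord0 /= /bump /=.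
  rewrite !addn0 ?add1n.
  have := eqP pm; rewrite lead_coefE p3E /= => ->.
  by rewrite pm1 b0 mul0r !expr1n; apply/eqP; ring.
have := pirr.2 ('X - 1%:P); rewrite size_XsubC dvdp_XsubCl p1.
by move=> /(_ isT isT) /eqp_size; rewrite size_XsubC p3E.
Qed.

(* If chi`_0 = -1 then chi is antipalindromic, so chi.[1] = 0 and p = 'X - 1. *)
Lemma even_char_coef0 m : 2%:R != 0 :> K -> n.+1 = (2 * m)%N ->
  (forall a, conj a = a) -> chi`_0 != -1.
Proof.
move=> two0 nm conj1; apply/eqP => c0.
have : chi.[1] = - chi.[1].
  rewrite (@horner_coef_wide _ n.+2) ?size_char_poly // -sumrN.
  rewrite [RHS](reindex_inj rev_ord_inj) /=; apply: eq_bigr => j _.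
  rewrite !expr1n !mulr1 subSS char_coef_dual -1?ltnS // !conj1 -/chi c0.
  by rewrite invrN1 mulN1r.
move/eqP; rewrite -addr_eq0 -mulr2n -mulr_natl mulf_eq0 (negPf two0) /=.
rewrite chip horner_exp expf_eq0 => /andP[_ p1].
have := pirr.2 ('X - 1%:P); rewrite size_XsubC dvdp_XsubCl => /(_ isT p1).
rewrite eqp_monic ?monicXsubC // => /eqP pE.
(* The constant coefficient of (x-1)^(2m) is 1, not -1. *)
move: c0; rewrite chip coef0_exp -pE coefB coefX coefC sub0r.
have -> : s = n.+1 by have := exponent_degree; rewrite -pE size_XsubC muln1.
rewrite nm exprM sqrrN !expr1n => /eqP.
by rewrite -addr_eq0 (negPf two0).
Qed.

End Fragments.

(** * Necessity of (C1) and (C2) *)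

Lemma trmx_exp (K : fieldType) n (M : 'M[K]_n.+1) k : (M ^+ k)^T = M^T ^+ k.
Proof.
elim: k => [|k IHk]; first by rewrite !expr0 trmx1.
by rewrite exprS exprSr -!mulmxE trmx_mul IHk.
Qed.

Section Necessity.
Variables (K : fieldType) (conj : {rmorphism K -> K}) (eps : K) (n : nat).
Variables (Phi X : 'M[K]_n.+1).
Hypothesis PhiF : frobenius_shape Phi.
Hypothesis Xgood : good_form conj eps Phi X.
Let chi := char_poly Phi.
Let A := star conj Phi.

Let XU : X \in unitmx. Proof. by case: Xgood. Qed.
Let XA : A * X * Phi = X. Proof. by case: Xgood => _ _ XE; rewrite [RHS]XE. Qed.

Lemma good_form_exp k : A ^+ k * X * Phi ^+ k = X.
Proof.
elim: k => [|k IHk]; first by rewrite mul1r mulr1.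
by rewrite exprSr exprS -!mulrA (mulrA X) (mulrA A) (mulrA A) XA mulrA IHk.
Qed.

Lemma char_poly_star : char_poly A = map_poly conj chi.
Proof.
rewrite /chi map_char_poly /A /star /char_poly -det_tr; congr (\det _).
by rewrite /char_poly_mx linearB /= tr_scalar_mx -map_trmx trmxK.
Qed.

Lemma good_form_coef0 : (char_poly Phi)`_0 != 0.
Proof.
rewrite char_poly_det mulf_eq0 signr_eq0 -unitfE -unitmxE.
by have := XU; rewrite -XA -!mulmxE unitmx_mul => /andP[].
Qed.

Lemma horner_mx_frobenius_inj (f : {poly K}) :
  (size f <= n.+1)%N -> horner_mx Phi f = 0 -> f = 0.
Proof.
move=> sf f0; apply/polyP=> i; rewrite coef0.
have [ni|ni] := ltnP i n.+1; last by rewrite nth_default // (leq_trans sf).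
by have := frobenius_horner PhiF (Ordinal ni) sf; rewrite f0 mxE.
Qed.

(** Since A^j X Phi^j = X, multiplying X Phi^(n+1) on the left by the conjugate of [chi] evaluated
    at [A] gives X f(Phi), with f the conjugate reversal of [chi]. The former is 0 by
    Cayley-Hamilton, so f(Phi) = 0. Then [chi] and its dual, both monic of degree n+1, differ by a
    polynomial of degree at most n that annihilates [Phi]. *)
Lemma good_form_dual : chi = dual conj chi.
Proof.
pose f := \poly_(j < n.+2) conj chi`_(n.+1 - j).
have fPhi : horner_mx Phi f = 0.
  have Xf : X * horner_mx Phi f = 0.
    have sf : (size f <= n.+2)%N by apply: size_poly.
    rewrite (horner_mx_sum Phi sf) mulr_sumr (reindex_inj rev_ord_inj) /=.
    have chiA : \sum_(j < n.+2) conj chi`_j *: A ^+ j = 0.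
      rewrite -[RHS](Cayley_Hamilton A) char_poly_star.
      rewrite (@horner_mx_sum _ _ _ _ n.+2) ?size_map_poly ?size_char_poly //.
      by apply: eq_bigr => j _; rewrite coef_map.
    transitivity ((\sum_(j < n.+2) conj chi`_j *: A ^+ j) * (X * Phi ^+ n.+1)).
      rewrite mulr_suml; apply: eq_bigr => j _.
      have jn : (j <= n.+1)%N by rewrite -ltnS.
      rewrite subSS coef_poly ltnS leq_subr subKn // -scalerAr -scalerAl.
      congr (_ *: _); rewrite -[in LHS](good_form_exp j) -!mulrA -exprD.
      by rewrite subnKC.
    by rewrite chiA mul0r.
  by apply: (mulrI XU); rewrite mulr0.
have lead : chi`_n.+1 = 1.
  by have /monicP := char_poly_monic Phi; rewrite lead_coefE size_char_poly.
have dE : dual conj chi = (conj chi`_0)^-1 *: f by rewrite /dual size_char_poly.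
apply/eqP; rewrite -subr_eq0; apply/eqP; apply: horner_mx_frobenius_inj.
  apply/leq_sizeP => j nj; rewrite dE coefB coefZ coef_poly.
  move: nj; rewrite leq_eqVlt => /orP[/eqP<-|nj].
    by rewrite ltnSn subnn lead mulVf ?subrr // fmorph_eq0 good_form_coef0.
  by rewrite ltnNge nj mulr0 nth_default ?subr0 ?size_char_poly.
by rewrite dE rmorphB /= linearZ /= fPhi scaler0 subr0 Cayley_Hamilton.
Qed.

Hypothesis conj1 : forall a, conj a = a.
Hypothesis epsP : eps = 1 \/ eps = -1.

Lemma good_form_linear (a : K) : chi = ('X + a%:P) ^+ n.+1 -> eps = (-1) ^+ n.
Proof.
move=> chiE; have epsK : eps * eps = 1.
  by case: epsP => ->; rewrite ?mulrNN mulr1.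
have a0 : a != 0.
  apply: contraNneq good_form_coef0 => a0.
  by rewrite -/chi chiE a0 addr0 coefXn.
have AE : A = Phi^T by rewrite /A /star map_mx_id.
have XT : X^T = eps *: X.
  have [_ XE _] := Xgood.
  by rewrite [in RHS]XE scalerA epsK scale1r /star map_mx_id.
pose N := Phi + a%:M.
have NE f : horner_mx Phi (('X + a%:P) ^+ f) = N ^+ f.
  by rewrite rmorphXn rmorphD /= horner_mx_X horner_mx_C.
have Nn : N ^+ n.+1 = 0 by rewrite -NE -chiE Cayley_Hamilton.
pose W := N ^+ n.
(* The first column of [W] lists the coefficients of (x+a)^n, so [W] is the last nonzero power of
   [N]. *)
have W1 : W ord_max 0 = 1.
  have sW : size (('X + a%:P) ^+ n) = n.+1.
    by rewrite -[a]opprK rmorphN size_exp_XsubC.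
  rewrite /W -NE frobenius_horner ?sW //=.
  by have := monicXaddC a => /(monic_exp n)/monicP; rewrite lead_coefE sW.
have W0 : col 0 W != 0.
  apply/eqP => /colP/(_ ord_max); rewrite [LHS]mxE W1 mxE => /eqP.
  by rewrite oner_eq0.
have PhiW : Phi * W = - a *: W.
  apply/eqP; rewrite scaleNr -addr_eq0 -mul_scalar_mx -mulrDl -exprS.
  by rewrite Nn.
have NA : N^T = A + a%:M by rewrite /N linearD /= tr_scalar_mx AE.
have Y0 : X *m col 0 W != 0.
  apply: contraNneq W0 => Y0; apply/eqP.
  by rewrite -[col 0 W](mulKmx XU) Y0 mulmx0.
have AY : A * (X * W) = - a^-1 *: (X * W).
  have E : - a *: (A * (X * W)) = X * W.
    by rewrite mulrA scalerAr -PhiW !mulrA XA.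
  by rewrite -[in RHS]E scalerA mulrNN mulVf ?scale1r.
(* [N^T] acts on the nonzero matrix X W as the scalar a - a^-1; being nilpotent, it forces that
   scalar to vanish. *)
have a2 : a * a = 1.
  have NY : N^T * (X * W) = (a - a^-1) *: (X * W).
    by rewrite NA mulrDl AY -mulmxE mul_scalar_mx -scalerDl addrC.
  have NYk k : N^T ^+ k * (X * W) = (a - a^-1) ^+ k *: (X * W).
    elim: k => [|k IHk]; first by rewrite mul1r scale1r.
    by rewrite exprSr -mulrA NY -scalerAr IHk scalerA exprS.
  have := NYk n.+1; rewrite -trmx_exp Nn trmx0 mul0r => /esym/eqP.
  rewrite scaler_eq0 expf_eq0 /= => /orP[|/eqP XW0].
    rewrite subr_eq0 => /eqP aE; apply: (mulIf a0).
    by rewrite mul1r {2}aE -mulrA mulVf ?mulr1.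
  by move: Y0; rewrite colE mulmxA mulmxE XW0 mul0mx eqxx.
have aV : a^-1 = a by apply: (mulfI a0); rewrite divff.
rewrite aV in AY.
have NX k : N^T ^+ k * X * Phi ^+ k = a ^+ k *: (X * N ^+ k).
  elim: k => [|k IHk]; first by rewrite mul1r !mulr1 scale1r.
  rewrite exprS exprSr mulrA -2!(mulrA N^T) IHk -scalerAr -scalerAl.
  rewrite -!mulrA.
  have cNP : N ^+ k * Phi = Phi * N ^+ k.
    apply/esym/commrX/commrD; first exact: commr_refl.
    by rewrite /GRing.comm -mulmxE scalar_mxC.
  rewrite cNP !mulrA.
  have -> : N^T * X * Phi = a *: (X * N).
    rewrite NA !mulrDl XA /N mulrDr scalerDr -!mulmxE mul_scalar_mx.
    by rewrite -scalemxAl mul_mx_scalar scalerA a2 scale1r addrC.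
  by rewrite -scalerAl scalerA -exprSr -mulrA -exprS.
have AYk k : A ^+ k * (X * W) = (- a) ^+ k *: (X * W).
  elim: k => [|k IHk]; first by rewrite mul1r scale1r.
  by rewrite exprSr -mulrA AY -scalerAr IHk scalerA -exprS.
(* Entry i of the first column of X W is the top entry of A^i X W, that is (-a)^i times its own top
   entry; so a zero top entry would kill the column. *)
have Y00 : (X * W) 0 0 != 0.
  apply: contraNneq Y0 => Y00; apply/eqP/colP=> i; rewrite !mxE.
  have -> : \sum_j X i j * col 0 W j 0 = (X * W) i 0.
    by rewrite mxE; apply: eq_bigr => j _; rewrite mxE.
  have <- : (A ^+ val i * (X * W)) 0 0 = (X * W) i 0.
    have -> : (X * W) i 0 =
        ((delta_mx (inord (val i)) 0 : 'cV_n.+1)^T *m (X * W)) 0 0.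
      by rewrite trmx_delta -rowE inord_val [RHS]mxE.
    rewrite -(frobenius_exp_delta PhiF) ?ltn_ord // trmx_mul trmx_exp -AE.
    by rewrite trmx_delta -mulmxA -rowE [RHS]mxE.
  by rewrite AYk mxE Y00 mulr0.
(* Transposing [NX] for k = n gives eps A^n X W = a^n (X W)^T, whose left side is eps (-a)^n X W.
   The corner entry, fixed by transposition, yields eps (-1)^n = 1. *)
have := congr1 (fun M : 'M_n.+1 => M^T 0 0) (NX n).
rewrite -trmx_exp -/W -!mulmxE !trmx_mul trmxK trmx_exp -AE XT.
rewrite -scalemxAl -scalemxAr.
rewrite !mulmxE AYk scalerA.
move: (X * W) Y00 => Y Y00; rewrite !mxE => /(mulIf Y00).
rewrite (exprNn a) mulrA -[X in _ = X -> _]mul1r => /(mulIf (expf_neq0 n a0)) E.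
by rewrite -[LHS]mulr1 -[X in eps * X](sqrr_sign _ n) expr2 mulrA E mul1r.
Qed.

End Necessity.

(** * Assembling the cases and both implications *)

Theorem theorem9 (K : fieldType) (conj : {rmorphism K -> K}) (eps : K)
    (n : nat) (Phi : 'M[K]_n) (p : {poly K}) (s : nat) :
  (2%:R : K) != 0 ->
  involutive conj ->
  (eps = 1 \/ eps = -1) ->
  (~ (forall a : K, conj a = a) -> eps = 1) ->
  (0 < n)%N ->
  frobenius_shape Phi ->
  p \is monic -> irreducible_poly p ->
  char_poly Phi = p ^+ s ->
  let chi := char_poly Phi in
  let alpha (k : nat) := chi`_(n - k) in
  let C1 := alpha n != 0 /\ chi = dual conj chi in
  let C2 := (forall a : K, conj a = a) -> eps = (-1) ^+ n -> (1 < (size p).-1)%N in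
  ((exists X : 'M[K]_n, good_form conj eps Phi X) <-> (C1 /\ C2)) /\
  (C1 -> C2 ->
   (* (a) *)
   (forall m : nat, n = (2 * m)%N -> alpha n != eps ->
      fragment_works conj eps Phi m
        (fun i : int => if i == - (m%:Z) then eps * conj (alpha n) - 1
                        else if i == m%:Z then alpha n - eps else 0)) /\
   (* (b) *)
   (forall m : nat, n = (2 * m)%N -> eps = 1 -> (forall a : K, conj a = a) ->
      fragment_works conj eps Phi m
        (fun i : int => if (i == - (m%:Z)) || (i == m%:Z) then alpha 1%N
                        else if (i == 1 - (m%:Z)) || (i == m%:Z - 1) then
                          (if m == 1%N then -2 else -1)
                        else 0)) /\
   (* (c) *)
   (forall k : K, k = - conj k -> k != 0 ->
      (forall m : nat, n = (2 * m)%N -> alpha n = 1 -> ~ (forall a : K, conj a = a) ->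
         fragment_works conj eps Phi m
           (fun i : int => if i == - (m%:Z) then - k else if i == m%:Z then k else 0)) /\
      (forall m : nat, n = (2 * m).+1 -> size p = 2%N -> (p`_0) ^+ (n - 1) = -1 ->
         fragment_works conj eps Phi m
           (fun i : int => if i == - (m%:Z) then - k else if i == m%:Z then k else 0))) /\
   (* (d) *)
   (forall m : nat, n = (2 * m).+1 -> ~ (size p = 2%N /\ (p`_0) ^+ (n - 1) = -1) ->
      fragment_works conj eps Phi m
        (fun i : int => if i == - (m%:Z) then eps else if i == m%:Z then 1 else 0))).
Proof.
move=> two0 conjK epsP epsN; case: n Phi => // n' Phi' _ PhiF pm pirr chip.
move=> chi alpha C1 C2.
have epsK : eps * eps = 1 by case: epsP => ->; rewrite ?mulrNN mulr1.
have eps0 : eps != 0.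
  apply/eqP => e0; move: epsK; rewrite e0 mul0r => /esym/eqP.
  by rewrite oner_eq0.
have conj_eps : conj eps = eps by case: epsP => ->; rewrite ?rmorphN rmorph1.
have N1 : (-1 : K) != 1.
  by rewrite eq_sym -subr_eq0 opprK.
have alphan : alpha n'.+1 = chi`_0 by rewrite /alpha subnn.
have alpha1 : alpha 1%N = chi`_n' by rewrite /alpha subSS subn0.
have pE : size p = 2%N -> p = 'X + (p`_0)%:P.
  move=> p2; apply/polyP => i; rewrite coefD coefX coefC.
  case: i => [|[|i]]; rewrite ?add0r ?addr0 //; last by rewrite nth_default ?p2.
  by have /monicP := pm; rewrite lead_coefE p2.
have sn : size p = 2%N -> s = n'.+1.
  by move=> p2; have := exponent_degree chip; rewrite p2 muln1.
have p0n : size p = 2%N -> chi`_0 = p`_0 ^+ n'.+1.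
  by move=> p2; rewrite /chi chip coef0_exp sn.
have size_p : (1 < size p)%N := pirr.1.
have not_id k : k = - conj k -> k != 0 -> ~ (forall a, conj a = a).
  move=> kN k0 conj1; move: kN; rewrite conj1 => /eqP.
  by rewrite -addr_eq0 -mulr2n -mulr_natl mulf_eq0 (negPf two0) (negPf k0).
(* The fragments come first, since existence of [X] is deduced from them. *)
have and_of_right (P Q : Prop) : Q -> (Q -> P) -> P /\ Q by auto.
apply: and_of_right => [|frag].
  rewrite alphan alpha1 /C1 alphan subSS subn0 => -[chi0 chi_dual] c2.
  have nrm := char_coef0_norm chi0 chi_dual; rewrite -/chi in nrm.
  have even := even_fragment conjK epsP PhiF chi0 chi_dual pm pirr chip.
  have odd := odd_fragment conjK epsP PhiF chi0 chi_dual pm pirr chip.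
  split; [|split; [|split]].
  - move=> m nm ce; apply: even => //.
    + apply: contraNneq ce => /eqP; rewrite subr_eq0 => /eqP ce.
      rewrite -[chi`_0]conjK -[conj chi`_0]mul1r -epsK -mulrA ce.
      by rewrite mulr1 conj_eps.
    + by rewrite rmorphB conj_eps mulrBr epsK.
    + transitivity (eps * (chi`_0 * conj chi`_0) - eps).
        by rewrite -/chi; ring.
      by rewrite nrm mulr1 subrr.
  - move=> m nm eps1 conj1.
    apply: (even_symmetric_fragment PhiF chi0 chi_dual pm pirr chip) => //.
    have : (1 < (size p).-1)%N.
      by apply: c2; rewrite // nm eps1 mulnC exprM sqrr_sign.
    by case: (size p) => // -[].
  - move=> k kN k0; have cid := not_id k kN k0; have eps1 := epsN cid; split.
    + move=> m nm c1 _; apply: even; rewrite // ?oppr_eq0 // ?eps1 ?mul1r.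
        by rewrite {1}kN opprK.
      by rewrite -/chi c1 mul1r addNr.
    + move=> m nm p2 pn; apply: odd; rewrite // ?oppr_eq0 // ?eps1 ?mul1r.
      * by rewrite {1}kN opprK.
      * move=> m0; have n0 : n' = 0%N by lia.
        by move: pn N1; rewrite n0 expr0 => <-; rewrite eqxx.
      * by move=> _ _; rewrite pn mulrNN mul1r -mulr2n -mulr_natl mulf_neq0.
  (* If eps = -1 the involution is trivial and, the order being odd, (C2) excludes linear [p]; this
     also rules out order 1. So only eps = 1 is left in the two side conditions. *)
  - move=> m nm np; apply: odd => //; rewrite ?rmorph1 ?mulr1 //.
    + move=> m0; case: epsP => // epsE; exfalso.
      have id1 : ~ ~ (forall a, conj a = a).
        by move=> /epsN e1; move: N1; rewrite -epsE e1 eqxx.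
      apply: id1 => id1; have n0 : n' = 0%N by lia.
      have := c2 id1; rewrite epsE n0 expr1 => /(_ erefl).
      have := exponent_degree chip; have := exponent_gt0 chip; rewrite n0.
      move: (size p).-1 => d; nia.
    + move=> p2 m0; case: epsP => epsE; rewrite epsE.
        by rewrite mulr1 addr_eq0; apply/eqP => pn; apply: np.
      exfalso; have id1 : ~ ~ (forall a, conj a = a).
        by move=> /epsN e1; move: N1; rewrite -epsE e1 eqxx.
      apply: id1 => id1; have := c2 id1; rewrite p2 epsE nm exprS exprM.
      by rewrite sqrrN expr1n expr1n mulr1 => /(_ erefl).
split=> [[X Xg]|[c1 c2]].
  have chi0 := good_form_coef0 Xg.
  split; first by split; [rewrite alphan|apply: good_form_dual Xg].
  move=> conj1 epsE; rewrite ltnNge; apply/negP => p2.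
  have {}p2 : size p = 2%N by lia.
  have chiE : char_poly Phi' = ('X + (p`_0)%:P) ^+ n'.+1.
    by rewrite -pE // chip sn.
  have := good_form_linear PhiF Xg conj1 epsP chiE.
  rewrite epsE exprS => /eqP; rewrite -subr_eq0 mulN1r -opprD oppr_eq0 -mulr2n.
  by rewrite -mulr_natl mulf_eq0 (negPf two0) signr_eq0.
have [fa [fb [fc fd]]] := frag c1 c2.
have [chi0 chi_dual] := c1; rewrite alphan in chi0 fa fc.
have nrm := char_coef0_norm chi0 chi_dual; rewrite -/chi in nrm.
suff [m [v [[a [ra av]] H]]] : exists m v, fragment_works conj eps Phi' m v.
  by exists (toeplitz n'.+1 a); apply: H.
have [m [nm|nm]] : exists m, n'.+1 = (2 * m)%N \/ n'.+1 = (2 * m).+1.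
- exists n'.+1./2; have := odd_double_half n'.+1.
  by case: (odd _) => /=; lia.
(* Even order: (a) applies unless the constant coefficient is eps. Then (b) serves the trivial
   involution, where eps = -1 is excluded by [even_char_coef0], and (c) the other, with k = a - conj
   a for any [a] that is moved. *)
- have [ce|ce] := eqVneq chi`_0 eps; last by exists m; eexists; apply: fa.
  have [conj1|nconj1] := classic (forall a, conj a = a).
    exists m; eexists; apply: fb => //; case: epsP => // epsE.
    have := even_char_coef0 chi_dual pm pirr chip two0 nm conj1.
    by rewrite -/chi ce epsE eqxx.
  have eps1 := epsN nconj1; have [a ca] := not_all_ex_not _ _ nconj1.
  have [||c1' _] := fc (a - conj a).
  + by rewrite rmorphB conjK opprB.
  + by rewrite subr_eq0 eq_sym; apply/eqP.
  by exists m; eexists; apply: c1'; rewrite ?ce.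
have [/andP[/eqP p2 /eqP pn]|np] :=
    boolP ((size p == 2%N) && (p`_0 ^+ (n'.+1 - 1) == -1)); last first.
  exists m; eexists; apply: fd => // -[/eqP p2 /eqP pn].
  by rewrite p2 pn in np.
(* Here p = 'X + a with a * conj a = 1 and a ^ 2 <> 1: take k = a - conj a. *)
have pcn : p`_0 * conj p`_0 = 1.
  move: nrm; rewrite p0n // rmorphXn -exprMn exprS; move: pn.
  rewrite subSS subn0 => pn.
  by rewrite exprMn -rmorphXn pn rmorphN rmorph1 mulrNN mulr1 mulr1.
have [||_ c2'] := fc (p`_0 - conj p`_0).
- by rewrite rmorphB conjK opprB.
- rewrite subr_eq0; apply: contraNneq N1 => pc; rewrite -pn subSS subn0.
  have -> : n' = (2 * m)%N by lia.
  by rewrite exprM expr2 {2}pc pcn expr1n.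
by exists m; eexists; apply: c2'.
Qed.
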